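(* Let $\tilde\alpha=\tilde\alpha(\bar s)$ be a unit speed regular dual curve on the dual unit sphere $\tilde S^2$ with dual Darboux frame $\{\tilde e,\tilde t,\tilde g\}$. The dual Smarandache $\tilde e\tilde g$-curve $\tilde\alpha_2=\frac{1}{\sqrt2}(\tilde e+\tilde g)$ of $\tilde\alpha$ is always a Bertrand offset of $\tilde\alpha$, with dual offset angle $\bar\theta=\pi/4+\varepsilon0$.
   Context: Dual numbers are $\bar a=a+\varepsilon a^*$ with $a,a^*\in\mathbb R$, $\varepsilon^2=0$; a differentiable real function is extended by $f(x+\varepsilon x^* )=f(x)+\varepsilon x^*f'(x)$. Dual vectors are $\tilde a=\vec a+\varepsilon\vec a^*$, $\vec a,\vec a^*\in\mathbb R^3$, with $\langle\tilde a,\tilde b\rangle=\langle\vec a,\vec b\rangle+\varepsilon(\langle\vec a,\vec b^*\rangle+\langle\vec a^*,\vec b\rangle)$, $\tilde a\times\tilde b=\vec a\times\vec b+\varepsilon(\vec a\times\vec b^*+\vec a^*\times\vec b)$, and norm $\|\tilde a\|=\|\vec a\|+\varepsilon\langle\vec a,\vec a^*\rangle/\|\vec a\|$ ($\vec a\ne0$). The dual unit sphere $\tilde S^2$ is the set of dual vectors with $\langle\tilde a,\tilde a\rangle=1+\varepsilon0$. Curves are smooth. For a regular dual curve on $\tilde S^2$ with position vector $\tilde e=\tilde\alpha$, $s$ denotes arc-length of the real part $\vec e$ (the real indicatrix), and the dual arc-length is $\bar s=\int\|d\tilde e/ds\|\,ds$; ''unit speed'' means that $\bar s$ is used as parameter,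 and $dF/d\bar s=(dF/ds)/(d\bar s/ds)$. The dual Darboux frame is $\tilde e$, $\tilde t=d\tilde e/d\bar s$, $\tilde g=\tilde e\times\tilde t$, and the dual spherical curvature $\bar\gamma$ is defined by $$\frac{d\tilde e}{d\bar s}=\tilde t,\quad \frac{d\tilde t}{d\bar s}=\bar\gamma\tilde g-\tilde e,\quad \frac{d\tilde g}{d\bar s}=-\bar\gamma\tilde t .$$ The quantities $\bar s_2,\tilde e_2=\tilde\alpha_2,\tilde t_2,\tilde g_2$ are the corresponding objects for $\tilde\alpha_2$ (a dual curve on $\tilde S^2$), where the dual arc-length parameter $\bar s_2$ is oriented so that $d\bar s_2/d\bar s=(1-\bar\gamma)/\sqrt2$; the curve $\tilde\alpha_2$ is considered where it is regular, i.e. where $1-\bar\gamma$ has nonzero real part. $\tilde\alpha_2$ is a Bertrand offset of $\tilde\alpha$ if $\tilde t_2=\tilde t$ at corresponding points. The dual offset angle is the dual angle $\bar\theta=\theta+\varepsilon\theta^*$ ($0\le\theta\le\pi$, $\theta^*\in\mathbb R$) between the generators $\tilde e$ and $\tilde e_2$, determined by $\langle\tilde e,\tilde e_2\rangle=\cos\bar\theta=\cos\theta-\varepsilon\theta^*\sin\theta$. *)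

(* Defs.v *)
From Stdlib Require Export Reals.
From Coquelicot Require Export Coquelicot.
Open Scope R_scope.

(* The space [R^3].  Addition, opposite, real scaling and derivatives of
   vector-valued curves are those of Coquelicot's product normed module. *)
Definition vec3 : Type := (R * (R * R))%type.

Definition vdot (a b : vec3) : R :=
  let '(a1, (a2, a3)) := a in
  let '(b1, (b2, b3)) := b in
  a1 * b1 + a2 * b2 + a3 * b3.

Definition vcross (a b : vec3) : vec3 :=
  let '(a1, (a2, a3)) := a in
  let '(b1, (b2, b3)) := b in
  (a2 * b3 - a3 * b2, (a3 * b1 - a1 * b3, a1 * b2 - a2 * b1)).

Definition vnorm (a : vec3) : R := sqrt (vdot a a).

(* [(x, y) : dual] stands for [x + eps y], and likewise for [dvec]. *)
Definition dual : Type := (R * R)%type.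
Definition dvec : Type := (vec3 * vec3)%type.

Definition dmul (x y : dual) : dual :=
  (fst x * fst y, fst x * snd y + snd x * fst y).

(* Meaningful only when [fst x <> 0]; only such [x] are invertible. *)
Definition dinv (x : dual) : dual := (/ fst x, - snd x / (fst x) ^ 2).

Definition dual_ext (f : R -> R) (x : dual) : dual :=
  (f (fst x), snd x * Derive f (fst x)).

Definition dvscal (x : dual) (a : dvec) : dvec :=
  (scal (fst x) (fst a),
   plus (scal (fst x) (snd a)) (scal (snd x) (fst a))).

Definition ddot (a b : dvec) : dual :=
  (vdot (fst a) (fst b), vdot (fst a) (snd b) + vdot (snd a) (fst b)).

Definition dcross (a b : dvec) : dvec :=
  (vcross (fst a) (fst b),
   plus (vcross (fst a) (snd b)) (vcross (snd a) (fst b))).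

Definition dnorm (a : dvec) : dual :=
  (vnorm (fst a), vdot (fst a) (snd a) / vnorm (fst a)).

Definition dual_unit_sphere (a : dvec) : Prop := ddot a a = (1, 0).

Definition smooth_on (D : R -> Prop) (f : R -> R) : Prop :=
  forall (n : nat) (s : R), D s -> ex_derive_n f n s.

Definition smooth_vec_on (D : R -> Prop) (v : R -> vec3) : Prop :=
  smooth_on D (fun s => fst (v s)) /\
  smooth_on D (fun s => fst (snd (v s))) /\
  smooth_on D (fun s => snd (snd (v s))).

Definition dual_spherical_curve (D : R -> Prop) (c : R -> dvec) : Prop :=
  smooth_vec_on D (fun s => fst (c s)) /\
  smooth_vec_on D (fun s => snd (c s)) /\
  (forall s, D s -> dual_unit_sphere (c s)).

Definition real_part_unit_speed (D : R -> Prop) (c : R -> dvec) : Prop :=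
  forall s, D s -> exists v : vec3,
    is_derive (fun u => fst (c u) : vec3) s v /\ vnorm v = 1.

(* [sb] is a primitive of [|dc/ds|].  The condition [fst dc <> zero] is the
   regularity of [c], without which [dnorm dc] is meaningless. *)
Definition dual_arclength (D : R -> Prop) (c : R -> dvec) (sb : R -> dual)
  : Prop :=
  forall s, D s -> exists dc : dvec,
    is_derive c s dc /\ fst dc <> zero /\ is_derive sb s (dnorm dc).

(* Same, but the parameter may run against the direction of increasing [s]. *)
Definition oriented_dual_arclength (D : R -> Prop) (c : R -> dvec)
  (sb : R -> dual) : Prop :=
  forall s, D s -> exists dc : dvec,
    is_derive c s dc /\ fst dc <> zero /\
    (is_derive sb s (dnorm dc) \/ is_derive sb s (opp (dnorm dc))).

(* [dF/dsb = (dF/ds) / (dsb/ds)], for [F] valued in dual numbers and in dual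
   vectors; both derivatives are required to exist and [dsb/ds] to be
   invertible. *)
Definition is_dual_derive_num (F sb : R -> dual) (s : R) (l : dual) : Prop :=
  exists dF dsb : dual,
    is_derive F s dF /\ is_derive sb s dsb /\ fst dsb <> 0 /\
    l = dmul (dinv dsb) dF.

Definition is_dual_derive (F : R -> dvec) (sb : R -> dual) (s : R) (l : dvec)
  : Prop :=
  exists (dF : dvec) (dsb : dual),
    is_derive F s dF /\ is_derive sb s dsb /\ fst dsb <> 0 /\
    l = dvscal (dinv dsb) dF.

(* [t] and [g] are the other two vectors of the dual Darboux frame of [e], and
   [gam] is its dual spherical curvature. *)
Definition dual_darboux (D : R -> Prop) (sb : R -> dual) (e t g : R -> dvec)
  (gam : R -> dual) : Prop :=
  forall s, D s ->
    g s = dcross (e s) (t s) /\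
    is_dual_derive e sb s (t s) /\
    is_dual_derive t sb s (minus (dvscal (gam s) (g s)) (e s)) /\
    is_dual_derive g sb s (opp (dvscal (gam s) (t s))).

(* Corresponding points are those with the same parameter [s]; the last clause
   says that the two dual tangents exist and coincide there. *)
Definition bertrand_offset (D : R -> Prop) (e : R -> dvec) (sb : R -> dual)
  (e2 : R -> dvec) (sb2 : R -> dual) : Prop :=
  dual_spherical_curve D e /\ oriented_dual_arclength D e sb /\
  dual_spherical_curve D e2 /\ oriented_dual_arclength D e2 sb2 /\
  (forall s, D s -> exists t : dvec,
     is_dual_derive e sb s t /\ is_dual_derive e2 sb2 s t).

Definition dual_offset_angle (a b : dvec) (th : dual) : Prop :=
  0 <= fst th <= PI /\ ddot a b = dual_ext cos th.

Definition smarandache_eg (e g : R -> dvec) (s : R) : dvec :=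
  scal (/ sqrt 2) (plus (e s) (g s)).

(* Main.v *)
Require Import Defs.
From Stdlib Require Import Reals Lra Lia Classical Wf_nat.
From Coquelicot Require Import Coquelicot.
Open Scope R_scope.

(** Writing [s'] for [d sb / ds], the frame equations give
    [d e2 / ds = s' (1 - gam) / sqrt 2 * t], so [t] is also the unit tangent of
    [e2] for the dual arc-length with derivative [s' (1 - gam) / sqrt 2], which is
    plus or minus the norm of [d e2 / ds].  Since [<e, g> = 0],
    [<e, e2> = 1 / sqrt 2 = cos (PI / 4)] with zero dual part.  Such an arc-length
    exists because [gam] is smooth: the real part of [e] has unit speed, so [s']
    is polynomial in the derivatives of [e], and hence so are [t], [g] and [gam]. *)

(** * Derivatives of pairs and of their components *)

Section Pairs.
Context {K : AbsRing} {U V : NormedModule K}.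

Lemma is_derive_fst (f : K -> U * V) x (l : U * V) :
  is_derive f x l -> is_derive (fun u => fst (f u)) x (fst l).
Proof.
intros Hf.
apply (filterdiff_ext_lin _ (fun y : K => fst (scal y l : U * V))); [|easy].
apply (filterdiff_comp' f (fun p : U * V => fst p) x (fun y => scal y l)
  (fun p : U * V => fst p) Hf).
apply filterdiff_linear, is_linear_fst.
Qed.

Lemma is_derive_snd (f : K -> U * V) x (l : U * V) :
  is_derive f x l -> is_derive (fun u => snd (f u)) x (snd l).
Proof.
intros Hf.
apply (filterdiff_ext_lin _ (fun y : K => snd (scal y l : U * V))); [|easy].
apply (filterdiff_comp' f (fun p : U * V => snd p) x (fun y => scal y l)
  (fun p : U * V => snd p) Hf).
apply filterdiff_linear, is_linear_snd.
Qed.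

Lemma is_derive_pair (f : K -> U) (g : K -> V) x (l : U) (m : V) :
  is_derive f x l -> is_derive g x m ->
  is_derive (fun u => (f u, g u)) x (l, m).
Proof.
intros Hf Hg.
apply (filterdiff_ext_lin _ (fun y : K => (scal y l, scal y m))); [|easy].
apply (filterdiff_comp'_2 f g (fun a b => (a, b)) x _ _ (fun a b => (a, b)) Hf Hg).
(* As a map on [U * V], pairing the two components is the identity, which is its own
   differential. *)
apply (filterdiff_ext (fun p : U * V => p)); [now intros []|].
apply (filterdiff_ext_lin _ (fun p : U * V => p)); [|now intros []].
apply filterdiff_id.
Qed.

End Pairs.

(** * Smooth real functions and their arithmetic *)

Lemma smooth_on_ex_derive D f s : smooth_on D f -> D s -> ex_derive f s.
Proof. intros Hf Ds; exact (Hf 1%nat s Ds). Qed.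

Lemma smooth_on_Derive D f : smooth_on D f -> smooth_on D (Derive f).
Proof.
(* [ex_derive_n _ 0] is [True]. For order [S n] the index is shifted: the [n]-th derivative of
   [Derive f] is the [S n]-th of [f]. *)
intros Hf [|n] s Ds; [exact I|].
apply ex_derive_ext with (Derive_n f (S n)).
- intros u; rewrite <- (Nat.add_1_r n); symmetry; exact (Derive_n_comp f n 1 u).
- exact (Hf (S (S n)) s Ds).
Qed.

Lemma smooth_on_const D c : smooth_on D (fun _ => c).
Proof. intros n s _; apply ex_derive_n_const. Qed.

Section Smooth.
Context {D : R -> Prop} (openD : open (D : R_UniformSpace -> Prop)).

(** Since [D] is open, agreement on [D] is agreement near each of its points, and derivatives of
    every order see no more than that. *)
Lemma smooth_on_ext f g :
  (forall s, D s -> f s = g s) -> smooth_on D f -> smooth_on D g.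
Proof.
intros Efg Hf n s Ds.
apply ex_derive_n_ext_loc with f; [|now apply Hf].
exact (locally_open _ _ openD Efg s Ds).
Qed.

Lemma smooth_on_plus f g :
  smooth_on D f -> smooth_on D g -> smooth_on D (fun s => f s + g s).
Proof.
intros Hf Hg n s Ds.
apply ex_derive_n_plus; apply (locally_open D); trivial;
  intros u Du k _; [now apply Hf|now apply Hg].
Qed.

Lemma smooth_on_opp f : smooth_on D f -> smooth_on D (fun s => - f s).
Proof. intros Hf n s Ds; apply ex_derive_n_opp, Hf, Ds. Qed.

Lemma smooth_on_minus f g :
  smooth_on D f -> smooth_on D g -> smooth_on D (fun s => f s - g s).
Proof. intros Hf Hg; apply smooth_on_plus, smooth_on_opp; assumption. Qed.

(** The product rule lowers the order: higher derivatives of [f g] are derivatives of [f' g + f g'].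
    The induction runs over all smooth pairs because [f] and [g] get replaced by their derivatives,
    and it is strong because the sum rule asks for all lower orders near the point. *)
Lemma smooth_on_mult f g :
  smooth_on D f -> smooth_on D g -> smooth_on D (fun s => f s * g s).
Proof.
intros Hf Hg n; revert f g Hf Hg.
induction n as [n IH] using lt_wf_ind; intros f g Hf Hg s Ds.
assert (H1 : forall u, D u -> Derive (fun v => f v * g v) u =
    Derive f u * g u + f u * Derive g u).
{ intros u Du; apply Derive_mult; eapply smooth_on_ex_derive; eassumption. }
destruct n as [|[|n]]; [exact I| |].
- apply ex_derive_mult; eapply smooth_on_ex_derive; eassumption.
- assert (H2 : ex_derive_n (Derive (fun v => f v * g v)) (S n) s).
  { apply ex_derive_n_ext_loc with
      (fun u => Derive f u * g u + f u * Derive g u).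
    { apply (locally_open D); [exact openD| |exact Ds].
      intros u Du; symmetry; now apply H1. }
    apply ex_derive_n_plus; apply (locally_open D); trivial;
      intros u Du k Hk; apply IH; auto using smooth_on_Derive; lia. }
  revert H2; apply ex_derive_ext; intros u.
  rewrite <- (Nat.add_1_r n); exact (Derive_n_comp _ n 1 u).
Qed.

(** * Smooth curves of dual numbers and dual vectors *)

Definition smooth_dual (x : R -> dual) : Prop :=
  smooth_on D (fun s => fst (x s)) /\ smooth_on D (fun s => snd (x s)).

Definition smooth_dvec (c : R -> dvec) : Prop :=
  smooth_vec_on D (fun s => fst (c s)) /\ smooth_vec_on D (fun s => snd (c s)).

Lemma smooth_dual_ext x y :
  (forall s, D s -> x s = y s) -> smooth_dual x -> smooth_dual y.
Proof.
intros E [H1 H2]; split;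
  [refine (smooth_on_ext _ _ _ H1) | refine (smooth_on_ext _ _ _ H2)];
  intros s Ds; now rewrite E.
Qed.

Lemma smooth_dvec_ext c d :
  (forall s, D s -> c s = d s) -> smooth_dvec c -> smooth_dvec d.
Proof.
intros E [(H1 & H2 & H3) (H4 & H5 & H6)]; split; (split; [|split]);
  [ refine (smooth_on_ext _ _ _ H1) | refine (smooth_on_ext _ _ _ H2)
  | refine (smooth_on_ext _ _ _ H3) | refine (smooth_on_ext _ _ _ H4)
  | refine (smooth_on_ext _ _ _ H5) | refine (smooth_on_ext _ _ _ H6) ];
  intros s Ds; cbv beta; now rewrite E.
Qed.

Ltac smooth :=
  lazymatch goal with
  | |- smooth_on _ (fun s => _ + _) => apply smooth_on_plus; smooth
  | |- smooth_on _ (fun s => _ - _) => apply smooth_on_minus; smooth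
  | |- smooth_on _ (fun s => _ * _) => apply smooth_on_mult; smooth
  | _ => assumption
  end.

Lemma smooth_vec_cross v w :
  smooth_vec_on D v -> smooth_vec_on D w ->
  smooth_vec_on D (fun s => vcross (v s) (w s)).
Proof.
intros (H1 & H2 & H3) (H4 & H5 & H6).
split; [|split].
- apply smooth_on_ext with (fun s =>
    fst (snd (v s)) * snd (snd (w s)) - snd (snd (v s)) * fst (snd (w s)));
  [|smooth].
  intros s _; now destruct (v s) as [? []], (w s) as [? []].
- apply smooth_on_ext with (fun s =>
    snd (snd (v s)) * fst (w s) - fst (v s) * snd (snd (w s))); [|smooth].
  intros s _; now destruct (v s) as [? []], (w s) as [? []].
- apply smooth_on_ext with (fun s =>
    fst (v s) * fst (snd (w s)) - fst (snd (v s)) * fst (w s)); [|smooth].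
  intros s _; now destruct (v s) as [? []], (w s) as [? []].
Qed.

Lemma smooth_on_vdot v w :
  smooth_vec_on D v -> smooth_vec_on D w ->
  smooth_on D (fun s => vdot (v s) (w s)).
Proof.
intros (H1 & H2 & H3) (H4 & H5 & H6).
apply smooth_on_ext with (fun s => fst (v s) * fst (w s) +
  fst (snd (v s)) * fst (snd (w s)) + snd (snd (v s)) * snd (snd (w s)));
  [|smooth].
intros s _; now destruct (v s) as [? []], (w s) as [? []].
Qed.

Lemma smooth_vec_plus v w :
  smooth_vec_on D v -> smooth_vec_on D w ->
  smooth_vec_on D (fun s => plus (v s) (w s)).
Proof.
intros (H1 & H2 & H3) (H4 & H5 & H6); split; [|split];
  apply smooth_on_plus; assumption.
Qed.

Lemma smooth_vec_scal f v :
  smooth_on D f -> smooth_vec_on D v ->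
  smooth_vec_on D (fun s => scal (f s) (v s)).
Proof.
intros Hf (H1 & H2 & H3); split; [|split]; apply smooth_on_mult; assumption.
Qed.

Lemma smooth_ddot c d :
  smooth_dvec c -> smooth_dvec d -> smooth_dual (fun s => ddot (c s) (d s)).
Proof.
intros [H1 H2] [H3 H4]; split; simpl; [|apply smooth_on_plus];
  apply smooth_on_vdot; assumption.
Qed.

Lemma smooth_dcross c d :
  smooth_dvec c -> smooth_dvec d -> smooth_dvec (fun s => dcross (c s) (d s)).
Proof.
intros [H1 H2] [H3 H4]; split;
  [|apply smooth_vec_plus]; apply smooth_vec_cross; assumption.
Qed.

Lemma smooth_dvscal x c :
  smooth_dual x -> smooth_dvec c -> smooth_dvec (fun s => dvscal (x s) (c s)).
Proof.
intros [H1 H2] [H3 H4]; split;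
  [|apply smooth_vec_plus]; apply smooth_vec_scal; assumption.
Qed.

Lemma smooth_dvec_plus c d :
  smooth_dvec c -> smooth_dvec d -> smooth_dvec (fun s => plus (c s) (d s)).
Proof.
intros [H1 H2] [H3 H4]; split; apply smooth_vec_plus; assumption.
Qed.

Lemma smooth_dvec_scal k c :
  smooth_dvec c -> smooth_dvec (fun s => scal k (c s)).
Proof.
intros [H1 H2]; split; apply smooth_vec_scal; auto using smooth_on_const.
Qed.

End Smooth.

(** * Algebra of dual numbers and dual vectors *)

Ltac R_ring :=
  cbn; unfold plus, opp, mult; simpl;
  (* The equality is restated at type [R], which the carriers of Coquelicot's structures hide from
     [ring]. *)
  lazymatch goal with |- ?x = ?y => change (@eq R x y) end; ring.

Ltac dual_unfold :=
  unfold dual_unit_sphere, ddot, dcross, dvscal, dmul, smarandache_eg, dual, dvec, vec3 in *;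
  repeat match goal with x : (_ * _)%type |- _ => destruct x end;
  cbn -[Rplus Rmult Ropp Rminus] in *.

Ltac dual_ring :=
  intros; dual_unfold; repeat apply (f_equal2 pair); R_ring.

Lemma dmul_comm x y : dmul x y = dmul y x.
Proof. dual_ring. Qed.

Lemma dmul_assoc x y z : dmul x (dmul y z) = dmul (dmul x y) z.
Proof. dual_ring. Qed.

Lemma dmul_1_l x : dmul (1, 0) x = x.
Proof. dual_ring. Qed.

Lemma dmul_dinv_l x : fst x <> 0 -> dmul (dinv x) x = (1, 0).
Proof. destruct x as [x y]; simpl; intros Hx; apply (f_equal2 pair); simpl; field; exact Hx. Qed.

(** Recovers [dF/ds] as [dsb/ds] times [dF/dsb] from the quotient that defines the latter;
    [dvscal_solve] does the same for dual vectors. *)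
Lemma dmul_solve x y z : fst x <> 0 -> z = dmul (dinv x) y -> y = dmul x z.
Proof.
intros Hx ->.
now rewrite dmul_assoc, (dmul_comm x), dmul_dinv_l, dmul_1_l.
Qed.

Lemma dvscal_assoc x y a : dvscal x (dvscal y a) = dvscal (dmul x y) a.
Proof. dual_ring. Qed.

Lemma dvscal_1 a : dvscal (1, 0) a = a.
Proof. dual_ring. Qed.

Lemma dvscal_dinv_l x a : fst x <> 0 -> dvscal (dinv x) (dvscal x a) = a.
Proof. intros Hx; now rewrite dvscal_assoc, dmul_dinv_l, dvscal_1. Qed.

Lemma dvscal_solve x a b : fst x <> 0 -> b = dvscal (dinv x) a -> a = dvscal x b.
Proof.
intros Hx ->.
now rewrite dvscal_assoc, dmul_comm, dmul_dinv_l, dvscal_1.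
Qed.

Lemma ddot_dvscal_l x a b : ddot (dvscal x a) b = dmul x (ddot a b).
Proof. dual_ring. Qed.

Lemma ddot_dvscal_r x a b : ddot a (dvscal x b) = dmul x (ddot a b).
Proof. dual_ring. Qed.

Lemma ddot_minus_l (a b c : dvec) : ddot (minus a b) c = minus (ddot a c) (ddot b c).
Proof. dual_ring. Qed.

Lemma ddot_dcross_l a b : ddot a (dcross a b) = (0, 0).
Proof. dual_ring. Qed.

(** Lagrange's identity: being polynomial, it carries over from the reals to the dual numbers. *)
Lemma ddot_dcross_dcross a b :
  ddot (dcross a b) (dcross a b) =
  minus (dmul (ddot a a) (ddot b b)) (dmul (ddot a b) (ddot a b)).
Proof. dual_ring. Qed.

(** * Norms of dual vectors *)

Lemma vdot_self_ge0 a : 0 <= vdot a a.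
Proof. destruct a as [x [y z]]; simpl; nra. Qed.

Lemma vdot_self_gt0 (a : vec3) : a <> zero -> 0 < vdot a a.
Proof.
intros Ha; destruct (vdot_self_ge0 a) as [|H]; [easy|].
destruct Ha; destruct a as [x [y z]]; simpl in H.
repeat apply (f_equal2 pair); change (@zero R_AbelianMonoid) with 0; nra.
Qed.

(** For a unit dual vector [u + eps v], [vdot u u = 1] and [vdot u v = 0], so scaling it by
    [x + eps y] gives the norm [|x| + eps x y / |x|]. This is the scalar itself up to the sign of
    its real part, which is the source of the two orientations allowed for the arc-length of
    [e2]. *)
Lemma dnorm_dvscal_unit x a :
  ddot a a = (1, 0) -> fst x <> 0 ->
  dnorm (dvscal x a) = x \/ dnorm (dvscal x a) = opp x.
Proof.
destruct x as [x y], a as [u v]; intros Ha Hx; simpl in Hx.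
injection Ha as Hu Huv.
assert (Huv' : vdot u v = 0).
{ destruct u as [? []], v as [? []]; simpl in *; lra. }
assert (E1 : vdot (scal x u) (scal x u) = x * x).
{ rewrite <- (Rmult_1_r (x * x)), <- Hu.
  destruct u as [? []]; R_ring. }
assert (E2 : vdot (scal x u) (plus (scal x v) (scal y u)) = x * y).
{ transitivity (x * x * vdot u v + x * y * vdot u u).
  - destruct u as [? []], v as [? []]; R_ring.
  - rewrite Hu, Huv'; ring. }
unfold dnorm, vnorm, dvscal; simpl fst; simpl snd; rewrite E1, E2.
fold (Rsqr x); rewrite sqrt_Rsqr_abs.
destruct (Rle_or_lt 0 x) as [H|H].
- left; rewrite Rabs_pos_eq by exact H; apply (f_equal2 pair); [easy|field; lra].
- right; rewrite Rabs_left by exact H; apply (f_equal2 pair); [easy|].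
  change (x * y / - x = - y); field; lra.
Qed.

(** The dual norm squares to [ddot a a], and it is invertible because its real part is positive, so
    normalising works as over the reals. *)
Lemma ddot_unit_tangent a :
  fst a <> zero ->
  ddot (dvscal (dinv (dnorm a)) a) (dvscal (dinv (dnorm a)) a) = (1, 0).
Proof.
intros Ha; rewrite ddot_dvscal_l, ddot_dvscal_r.
destruct a as [u v]; simpl in Ha.
assert (Hv : 0 < vnorm u) by (apply sqrt_lt_R0, vdot_self_gt0, Ha).
assert (Hu : vdot u u = vnorm u * vnorm u)
  by (symmetry; apply sqrt_sqrt, vdot_self_ge0).
assert (Huv : vdot v u = vdot u v)
  by (destruct u as [? []], v as [? []]; simpl; ring).
unfold ddot, dnorm, dinv, dmul; simpl fst; simpl snd; rewrite Huv, Hu.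
apply (f_equal2 pair); field; lra.
Qed.

(** * Differentiation of dual curves *)

Definition dual_D (x : R -> dual) (s : R) : dual :=
  (Derive (fun u => fst (x u)) s, Derive (fun u => snd (x u)) s).

Definition vec_D (v : R -> vec3) (s : R) : vec3 :=
  (Derive (fun u => fst (v u)) s,
   (Derive (fun u => fst (snd (v u))) s, Derive (fun u => snd (snd (v u))) s)).

Definition dvec_D (c : R -> dvec) (s : R) : dvec :=
  (vec_D (fun u => fst (c u)) s, vec_D (fun u => snd (c u)) s).

(** This and its two analogues identify derivatives that are only given existentially with the total
    functions [dual_D], [vec_D] and [dvec_D], about which smoothness can be stated. *)
Lemma dual_D_unique (x : R -> dual) s l : is_derive x s l -> dual_D x s = l.
Proof.
intros H; destruct l as [l1 l2]; apply (f_equal2 pair); apply is_derive_unique.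
- exact (is_derive_fst _ _ _ H).
- exact (is_derive_snd _ _ _ H).
Qed.

Lemma vec_D_unique (v : R -> vec3) s l : is_derive v s l -> vec_D v s = l.
Proof.
intros H; destruct l as [l1 [l2 l3]]; repeat apply (f_equal2 pair);
  apply is_derive_unique.
- exact (is_derive_fst _ _ _ H).
- exact (is_derive_fst _ _ _ (is_derive_snd _ _ _ H)).
- exact (is_derive_snd _ _ _ (is_derive_snd _ _ _ H)).
Qed.

Lemma dvec_D_unique (c : R -> dvec) s l : is_derive c s l -> dvec_D c s = l.
Proof.
intros H; destruct l as [l1 l2]; apply (f_equal2 pair); apply vec_D_unique.
- exact (is_derive_fst _ _ _ H).
- exact (is_derive_snd _ _ _ H).
Qed.

Lemma smooth_dvec_D D c : @smooth_dvec D c -> @smooth_dvec D (dvec_D c).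
Proof.
intros [(H1 & H2 & H3) (H4 & H5 & H6)]; split; (split; [|split]);
  apply smooth_on_Derive; assumption.
Qed.

Lemma is_derive_Rmult (f h : R -> R) (s l m : R) :
  is_derive f s l -> is_derive h s m ->
  is_derive (fun u => f u * h u) s (l * h s + f s * m).
Proof. intros Hf Hh; exact (is_derive_mult f h s l m Hf Hh Rmult_comm). Qed.

Lemma is_derive_vdot (v w : R -> vec3) s (dv dw : vec3) :
  is_derive v s dv -> is_derive w s dw ->
  is_derive (fun u => vdot (v u) (w u)) s (vdot dv (w s) + vdot (v s) dw).
Proof.
intros Hv Hw.
apply (is_derive_ext (fun u => fst (v u) * fst (w u) +
  fst (snd (v u)) * fst (snd (w u)) + snd (snd (v u)) * snd (snd (w u)))).
{ intros u; now destruct (v u) as [? []], (w u) as [? []]. }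
pose proof (is_derive_fst _ _ _ Hv) as Hv1.
pose proof (is_derive_fst _ _ _ (is_derive_snd _ _ _ Hv)) as Hv2.
pose proof (is_derive_snd _ _ _ (is_derive_snd _ _ _ Hv)) as Hv3.
pose proof (is_derive_fst _ _ _ Hw) as Hw1.
pose proof (is_derive_fst _ _ _ (is_derive_snd _ _ _ Hw)) as Hw2.
pose proof (is_derive_snd _ _ _ (is_derive_snd _ _ _ Hw)) as Hw3.
replace (vdot dv (w s) + vdot (v s) dw) with
  ((fst dv * fst (w s) + fst (v s) * fst dw) +
   (fst (snd dv) * fst (snd (w s)) + fst (snd (v s)) * fst (snd dw)) +
   (snd (snd dv) * snd (snd (w s)) + snd (snd (v s)) * snd (snd dw))).
2:{ destruct dv as [? []], dw as [? []], (v s) as [? []], (w s) as [? []].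
    simpl; ring. }
apply (is_derive_plus (V := R_NormedModule)); [apply (is_derive_plus (V := R_NormedModule))|];
  now apply is_derive_Rmult.
Qed.

Lemma is_derive_ddot (c d : R -> dvec) s (dc dd : dvec) :
  is_derive c s dc -> is_derive d s dd ->
  is_derive (fun u => ddot (c u) (d u) : dual) s
    (plus (ddot dc (d s)) (ddot (c s) dd) : dual).
Proof.
intros Hc Hd.
pose proof (is_derive_fst _ _ _ Hc) as Hc1.
pose proof (is_derive_snd _ _ _ Hc) as Hc2.
pose proof (is_derive_fst _ _ _ Hd) as Hd1.
pose proof (is_derive_snd _ _ _ Hd) as Hd2.
apply is_derive_pair; [exact (is_derive_vdot _ _ _ _ _ Hc1 Hd1)|].
match goal with |- is_derive _ _ ?l => replace l with
  (plus (vdot (fst dc) (snd (d s)) + vdot (fst (c s)) (snd dd))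
     (vdot (snd dc) (fst (d s)) + vdot (snd (c s)) (fst dd))) end.
2:{ R_ring. }
apply (is_derive_plus (V := R_NormedModule)).
- exact (is_derive_vdot _ _ _ _ _ Hc1 Hd2).
- exact (is_derive_vdot _ _ _ _ _ Hc2 Hd1).
Qed.

(** Near [s] the product [ddot c c] is constant, because [D] is open. Its derivative is twice
    [ddot (c s) dc] by symmetry, hence this vanishes. *)
Lemma ddot_unit_derive (D : R -> Prop) (c : R -> dvec) s (dc : dvec) :
  open (D : R_UniformSpace -> Prop) -> D s ->
  (forall u, D u -> dual_unit_sphere (c u)) ->
  is_derive c s dc -> ddot (c s) dc = (0, 0).
Proof.
intros openD Ds Hc Hdc.
pose proof (dual_D_unique _ _ _ (is_derive_ddot c c s dc dc Hdc Hdc)) as E.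
assert (E0 : dual_D (fun u => ddot (c u) (c u)) s = (0, 0)).
{ apply dual_D_unique.
  apply (is_derive_ext_loc (fun _ => (1, 0) : dual)).
  - apply (locally_open D); [exact openD| |exact Ds].
    intros u Du; symmetry; now apply Hc.
  - exact (is_derive_const ((1, 0) : dual) s). }
apply (eq_trans (eq_sym E0)) in E; clear - E.
destruct (c s) as [[? []] [? []]], dc as [[? []] [? []]].
unfold ddot in *; simpl in *; injection E as E1 E2.
unfold plus in *; simpl in *; apply (f_equal2 pair); lra.
Qed.

(** Convexity keeps the whole integration interval from [s0] inside [D], where [f] is continuous;
    openness provides integrability up to every point near [s]. *)
Lemma continuous_primitive (D : R -> Prop) (f : R -> R) s0 :
  open (D : R_UniformSpace -> Prop) ->
  (forall x y z, D x -> D y -> x <= z <= y -> D z) -> D s0 ->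
  (forall s, D s -> continuous f s) ->
  forall s, D s -> is_derive (RInt f s0) s (f s).
Proof.
intros openD convD D0 Hf s Ds.
apply is_derive_RInt with s0; [|now apply Hf].
apply (locally_open D); [exact openD| |exact Ds].
intros u Du; apply (RInt_correct (V := R_CompleteNormedModule)), ex_RInt_continuous; intros z Hz; apply Hf.
destruct (Rle_or_lt s0 u).
- rewrite Rmin_left, Rmax_right in Hz by lra; now apply (convD s0 u).
- rewrite Rmin_right, Rmax_left in Hz by lra; now apply (convD u s0).
Qed.

Lemma is_derive_scal_dvec k (c : R -> dvec) s (l : dvec) :
  is_derive c s l -> is_derive (fun u => scal k (c u)) s (scal k l).
Proof.
intros H.
apply (filterdiff_ext_lin _ (fun y : R => scal k (scal y l))).
- apply (filterdiff_comp' c (fun v : dvec => scal k v) s _ (fun v : dvec => scal k v) H).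
  apply filterdiff_linear.
  exact (is_linear_scal_r k Rmult_comm).
- intros y; rewrite !scal_assoc; f_equal; apply Rmult_comm.
Qed.

(** * The Darboux frame: orthonormality and smoothness *)

Section Frame.
Context {D : R -> Prop} {e t g : R -> dvec} {sb gam : R -> dual}
  (openD : open (D : R_UniformSpace -> Prop))
  (e_sph : dual_spherical_curve D e) (e_unit : real_part_unit_speed D e)
  (e_arc : dual_arclength D e sb) (darboux : dual_darboux D sb e t g gam).

(** Unit speed of the real part makes the root and the quotient in [dnorm] trivial, so the
    smoothness of [dsb/ds] and of its inverse comes down to sums and products. *)
Lemma dual_D_arclength s : D s ->
  dual_D sb s = (1, vdot (fst (dvec_D e s)) (snd (dvec_D e s))).
Proof.
intros Ds.
destruct (e_arc s Ds) as (de & Hde & _ & Hsb).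
destruct (e_unit s Ds) as (v & Hv & Nv).
rewrite (dual_D_unique _ _ _ Hsb), (dvec_D_unique _ _ _ Hde).
assert (E : fst de = v).
{ transitivity (vec_D (fun u => fst (e u)) s).
  - symmetry; exact (vec_D_unique _ _ _ (is_derive_fst _ _ _ Hde)).
  - exact (vec_D_unique _ _ _ Hv). }
unfold dnorm; rewrite E, Nv.
apply (f_equal2 pair); field.
Qed.

Lemma fst_dual_D_arclength s : D s -> fst (dual_D sb s) <> 0.
Proof. intros Ds; rewrite dual_D_arclength by exact Ds; apply R1_neq_R0. Qed.

Lemma is_derive_arclength s : D s -> is_derive sb s (dual_D sb s).
Proof.
intros Ds; destruct (e_arc s Ds) as (de & _ & _ & Hsb).
now rewrite (dual_D_unique _ _ _ Hsb).
Qed.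

(** The first half serves to differentiate [e2] along [s]; the second is an explicit formula for the
    frame derivatives, from which unit length, orthogonality and smoothness are read off. *)
Lemma is_dual_derive_D c l s : is_dual_derive c sb s l ->
  is_derive c s (dvscal (dual_D sb s) l) /\
  l = dvscal (dinv (dual_D sb s)) (dvec_D c s).
Proof.
intros (dc & dsb & Hc & Hsb & H0 & E).
rewrite (dual_D_unique _ _ _ Hsb), (dvec_D_unique _ _ _ Hc).
split; [|exact E].
now rewrite <- (dvscal_solve _ _ _ H0 E).
Qed.

Lemma darboux_tangent_unit s : D s -> ddot (t s) (t s) = (1, 0).
Proof.
intros Ds; destruct (darboux s Ds) as (_ & He & _ & _).
destruct (e_arc s Ds) as (de & Hde & H0 & Hsb).
destruct (is_dual_derive_D _ _ _ He) as [_ ->].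
rewrite (dual_D_unique _ _ _ Hsb), (dvec_D_unique _ _ _ Hde).
now apply ddot_unit_tangent.
Qed.

Lemma darboux_tangent_orth s : D s -> ddot (e s) (t s) = (0, 0).
Proof.
intros Ds; destruct (darboux s Ds) as (_ & He & _ & _).
destruct (e_arc s Ds) as (de & Hde & _ & _).
destruct (is_dual_derive_D _ _ _ He) as [_ ->].
rewrite ddot_dvscal_r, (dvec_D_unique _ _ _ Hde).
destruct e_sph as (_ & _ & Hs).
rewrite (ddot_unit_derive D e s de openD Ds Hs Hde).
unfold dmul; simpl; apply (f_equal2 pair); ring.
Qed.

Lemma darboux_normal_orth s : D s -> ddot (e s) (g s) = (0, 0).
Proof.
intros Ds; destruct (darboux s Ds) as (-> & _).
apply ddot_dcross_l.
Qed.

Lemma darboux_normal_unit s : D s -> ddot (g s) (g s) = (1, 0).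
Proof.
intros Ds; destruct (darboux s Ds) as (-> & _).
destruct e_sph as (_ & _ & Hs).
rewrite ddot_dcross_dcross, (Hs s Ds), darboux_tangent_unit,
  darboux_tangent_orth by exact Ds.
apply (f_equal2 pair); R_ring.
Qed.

Lemma smooth_dinv_arclength :
  @smooth_dual D (dual_D sb) /\ @smooth_dual D (fun s => dinv (dual_D sb s)).
Proof.
assert (He : @smooth_dvec D e) by (destruct e_sph as (? & ? & _); now split).
destruct (smooth_dvec_D _ _ He) as [H1 H2].
pose proof (smooth_on_vdot openD _ _ H1 H2) as H.
split.
- apply (smooth_dual_ext openD
    (fun s => (1, vdot (fst (dvec_D e s)) (snd (dvec_D e s))))).
  + intros s Ds; now rewrite dual_D_arclength.
  + split; [exact (smooth_on_const D 1)|exact H].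
(* The inverse of [1 + eps y] is [1 - eps y]. *)
- apply (smooth_dual_ext openD
    (fun s => (1, - vdot (fst (dvec_D e s)) (snd (dvec_D e s))))).
  + intros s Ds; rewrite dual_D_arclength by exact Ds.
    unfold dinv; simpl; apply (f_equal2 pair); field.
  + split; [exact (smooth_on_const D 1)|exact (smooth_on_opp _ H)].
Qed.

(** Smoothness passes from [e] to [t] by differentiation, to [g] by the cross product, and to [gam]
    by one more differentiation. It makes [e2] a smooth curve and its speed integrable. *)
Lemma smooth_darboux :
  @smooth_dvec D t /\ @smooth_dvec D g /\ @smooth_dual D gam.
Proof.
assert (He : @smooth_dvec D e) by (destruct e_sph as (? & ? & _); now split).
destruct smooth_dinv_arclength as [_ Hi].
assert (Ht : @smooth_dvec D t).
{ apply (smooth_dvec_ext openD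
    (fun s => dvscal (dinv (dual_D sb s)) (dvec_D e s))).
  - intros s Ds; destruct (darboux s Ds) as (_ & Hd & _).
    symmetry; apply (is_dual_derive_D _ _ _ Hd).
  - apply (smooth_dvscal openD); [exact Hi|now apply smooth_dvec_D]. }
assert (Hg : @smooth_dvec D g).
{ apply (smooth_dvec_ext openD (fun s => dcross (e s) (t s))).
  - intros s Ds; symmetry; apply (darboux s Ds).
  - now apply smooth_dcross. }
split; [exact Ht|split; [exact Hg|]].
(* [gam] is the [g]-component of [dt/dsb]. *)
apply (smooth_dual_ext openD (fun s =>
  ddot (dvscal (dinv (dual_D sb s)) (dvec_D t s)) (g s))).
- intros s Ds; destruct (darboux s Ds) as (_ & _ & Hd & _).
  destruct (is_dual_derive_D _ _ _ Hd) as [_ <-].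
  rewrite ddot_minus_l, ddot_dvscal_l, darboux_normal_unit,
    darboux_normal_orth by exact Ds.
  destruct (gam s); apply (f_equal2 pair); R_ring.
- apply (smooth_ddot openD); [|exact Hg].
  apply (smooth_dvscal openD); [exact Hi|now apply smooth_dvec_D].
Qed.

(** * The Smarandache curve and its dual arc-length *)

Lemma smarandache_eg_derive s : D s ->
  is_derive (smarandache_eg e g) s
    (dvscal (dmul (dual_D sb s) (scal (/ sqrt 2) (minus ((1, 0) : dual) (gam s))))
      (t s)).
Proof.
intros Ds; destruct (darboux s Ds) as (_ & He & _ & Hg).
apply is_dual_derive_D in He, Hg.
destruct He as [He _], Hg as [Hg _].
pose proof (is_derive_scal_dvec (/ sqrt 2) _ _ _ (is_derive_plus _ _ _ _ _ He Hg)) as H.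
match type of H with is_derive _ _ ?l => replace (dvscal _ _) with l end.
- exact H.
- generalize (dual_D sb s) (gam s) (t s) (/ sqrt 2); dual_ring.
Qed.

Lemma ddot_smarandache_eg_l s : D s ->
  ddot (e s) (smarandache_eg e g s) = (/ sqrt 2, 0).
Proof.
intros Ds.
transitivity (dmul (/ sqrt 2, 0) (plus (ddot (e s) (e s)) (ddot (e s) (g s)) : dual)).
- unfold smarandache_eg; generalize (e s) (g s) (/ sqrt 2); dual_ring.
- destruct e_sph as (_ & _ & Hs).
  rewrite (Hs s Ds), darboux_normal_orth by exact Ds.
  apply (f_equal2 pair); R_ring.
Qed.

Lemma smarandache_eg_spherical : dual_spherical_curve D (smarandache_eg e g).
Proof.
destruct e_sph as (H1 & H2 & Hs).
assert (H : @smooth_dvec D (smarandache_eg e g)).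
{ apply smooth_dvec_scal, smooth_dvec_plus; try exact openD.
  - now split.
  - apply smooth_darboux. }
split; [apply H|split; [apply H|]].
intros s Ds; unfold dual_unit_sphere.
(* Bilinear expansion: the mixed terms [<e, g>] vanish, and the factor [1/2] normalises
   [<e, e> + <g, g> = 2]. *)
transitivity (dmul (/ sqrt 2 * / sqrt 2, 0)
  (plus (plus (ddot (e s) (e s)) (ddot (g s) (g s)))
     (plus (ddot (e s) (g s)) (ddot (e s) (g s))) : dual)).
- unfold smarandache_eg; generalize (e s) (g s) (/ sqrt 2); dual_ring.
- rewrite (Hs s Ds), darboux_normal_orth, darboux_normal_unit by exact Ds.
  rewrite <- Rinv_mult, sqrt_sqrt by lra.
  apply (f_equal2 pair); cbn; unfold plus; simpl; lra.
Qed.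

Lemma dual_primitive (x : R -> dual) :
  (forall u v w, D u -> D v -> u <= w <= v -> D w) -> @smooth_dual D x ->
  exists y : R -> dual, forall s, D s -> is_derive y s (x s).
Proof.
intros convD [H1 H2].
(* The integral starts at some point of [D]; if [D] is empty, any function will do. *)
destruct (classic (exists s0, D s0)) as [[s0 D0]|D0].
- exists (fun s => (RInt (fun u => fst (x u)) s0 s, RInt (fun u => snd (x u)) s0 s)).
  intros s Ds; rewrite (surjective_pairing (x s)).
  apply is_derive_pair.
  + apply (continuous_primitive D (fun u => fst (x u))); try assumption.
    intros u Du; apply (ex_derive_continuous (V := R_NormedModule)).
    exact (smooth_on_ex_derive _ _ _ H1 Du).
  + apply (continuous_primitive D (fun u => snd (x u))); try assumption.
    intros u Du; apply (ex_derive_continuous (V := R_NormedModule)).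
    exact (smooth_on_ex_derive _ _ _ H2 Du).
- exists (fun _ => (0, 0)); intros s Ds; destruct D0; now exists s.
Qed.

Lemma smarandache_eg_arclength_exists :
  (forall u v w, D u -> D v -> u <= w <= v -> D w) ->
  exists sb2 : R -> dual, forall s, D s ->
    is_dual_derive_num sb2 sb s
      (scal (/ sqrt 2) (minus ((1, 0) : dual) (gam s))).
Proof.
intros convD.
destruct (dual_primitive (fun s => dmul (dual_D sb s)
  (scal (/ sqrt 2) (minus ((1, 0) : dual) (gam s)))) convD) as [sb2 H].
- destruct smooth_darboux as (_ & _ & G1 & G2).
  destruct smooth_dinv_arclength as [[S1 S2] _].
  assert (M1 : smooth_on D (fun s => / sqrt 2 * (1 - fst (gam s)))).
  { apply (smooth_on_mult openD); [apply smooth_on_const|].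
    apply (smooth_on_minus openD); [apply smooth_on_const|exact G1]. }
  assert (M2 : smooth_on D (fun s => / sqrt 2 * (0 - snd (gam s)))).
  { apply (smooth_on_mult openD); [apply smooth_on_const|].
    apply (smooth_on_minus openD); [apply smooth_on_const|exact G2]. }
  split.
  + exact (smooth_on_mult openD _ _ S1 M1).
  + exact (smooth_on_plus openD _ _ (smooth_on_mult openD _ _ S1 M2)
      (smooth_on_mult openD _ _ S2 M1)).
- exists sb2; intros s Ds.
  eexists _, _; split; [exact (H s Ds)|].
  split; [exact (is_derive_arclength s Ds)|].
  pose proof (fst_dual_D_arclength s Ds) as H0.
  split; [exact H0|].
  now rewrite dmul_assoc, dmul_dinv_l, dmul_1_l.
Qed.

Lemma smarandache_eg_arclength_derive sb2 s :
  is_dual_derive_num sb2 sb s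
    (scal (/ sqrt 2) (minus ((1, 0) : dual) (gam s))) ->
  is_derive sb2 s
    (dmul (dual_D sb s) (scal (/ sqrt 2) (minus ((1, 0) : dual) (gam s)))).
Proof.
intros (dsb2 & dsb & H2 & H & H0 & E).
rewrite (dual_D_unique _ _ _ H).
now rewrite <- (dmul_solve _ _ _ H0 E).
Qed.

Lemma smarandache_eg_speed_neq0 s : D s -> 1 - fst (gam s) <> 0 ->
  fst (dmul (dual_D sb s)
    (scal (/ sqrt 2) (minus ((1, 0) : dual) (gam s)))) <> 0.
Proof.
intros Ds Hg.
change (fst (dual_D sb s) * (/ sqrt 2 * (1 - fst (gam s))) <> 0).
repeat apply Rmult_integral_contrapositive_currified.
- exact (fst_dual_D_arclength s Ds).
- apply Rinv_neq_0_compat, sqrt2_neq_0.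
- exact Hg.
Qed.

End Frame.

(** * Regularity of the offset curve and its offset angle *)

Lemma fst_dvscal_unit_neq0 x a :
  ddot a a = (1, 0) -> fst x <> 0 -> fst (dvscal x a) <> zero.
Proof.
intros Ha Hx E.
assert (E1 : vdot (fst (dvscal x a)) (fst (dvscal x a)) = fst x * fst x).
{ change (fst (ddot (dvscal x a) (dvscal x a)) = fst x * fst x).
  rewrite ddot_dvscal_l, ddot_dvscal_r, Ha; simpl; ring. }
rewrite E in E1.
change (0 * 0 + 0 * 0 + 0 * 0 = fst x * fst x) in E1; nra.
Qed.

(** The real part determines the angle because [cos] is injective on [[0, PI]]. The dual part
    [- y * sin (PI / 4)] then forces [y = 0], the sine being nonzero. *)
Lemma dual_ext_cos_eq_pi4 th : 0 <= fst th <= PI ->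
  dual_ext cos th = (/ sqrt 2, 0) <-> th = (PI / 4, 0).
Proof.
intros Hth; destruct th as [x y]; simpl in Hth; unfold dual_ext; simpl.
pose proof PI_RGT_0 as HPI.
assert (C4 : cos (PI / 4) = / sqrt 2) by (rewrite cos_PI4; field; apply sqrt2_neq_0).
split; intros H; injection H as Hx Hy.
- rewrite <- C4 in Hx; apply cos_inj in Hx; [subst x|lra|lra].
  rewrite (is_derive_unique _ _ _ (is_derive_cos (PI / 4))), sin_cos_PI4, C4 in Hy.
  apply Rmult_integral in Hy; destruct Hy as [->|Hy]; [easy|].
  pose proof (Rinv_neq_0_compat _ sqrt2_neq_0); lra.
- subst; rewrite C4; apply (f_equal2 pair); ring.
Qed.

Theorem corollary5p4 (a b : Rbar) (e t g : R -> dvec) (sb gam : R -> dual) :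
  let I := fun s : R => Rbar_lt a s /\ Rbar_lt s b in
  let J := fun s : R => I s /\ 1 - fst (gam s) <> 0 in
  let e2 := smarandache_eg e g in
  let oriented_by_gam := fun sb2 : R -> dual =>
    forall s, J s ->
      is_dual_derive_num sb2 sb s
        (scal (/ sqrt 2) (minus ((1, 0) : dual) (gam s))) in
  dual_spherical_curve I e ->
  real_part_unit_speed I e ->
  dual_arclength I e sb ->
  dual_darboux I sb e t g gam ->
  (exists sb2 : R -> dual, oriented_by_gam sb2) /\
  (forall sb2 : R -> dual, oriented_by_gam sb2 ->
     bertrand_offset J e sb e2 sb2) /\
  (forall s, J s -> forall th : dual,
     dual_offset_angle (e s) (e2 s) th <-> th = (PI / 4, 0)).
Proof.
intros I J e2 oriented_by_gam e_sph e_unit e_arc darboux.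
assert (openI : open (I : R_UniformSpace -> Prop)).
{ apply open_and; [apply open_Rbar_gt|apply open_Rbar_lt]. }
assert (convI : forall u v w, I u -> I v -> u <= w <= v -> I w).
{ intros u v w [Hu _] [_ Hv] [H1 H2]; split.
  - exact (Rbar_lt_le_trans a u w Hu H1).
  - exact (Rbar_le_lt_trans w v b H2 Hv). }
(* The frame lemmas are applied on the open interval [I]; being pointwise in [s], their conclusions
   restrict to [J]. *)
assert (restrict : forall c, dual_spherical_curve I c -> dual_spherical_curve J c).
{ intros c (H1 & H2 & H3); split; [|split].
  - split; [|split]; intros n s [Is _]; now apply H1.
  - split; [|split]; intros n s [Is _]; now apply H2.
  - intros s [Is _]; now apply H3. }
split; [|split].
(* The speed is integrated over all of [I], zeros of [1 - gam] included, since [J] may fail to be an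
   interval. *)
- destruct (smarandache_eg_arclength_exists openI e_sph e_unit e_arc darboux convI)
    as [sb2 H].
  exists sb2; intros s [Is _]; now apply H.
- intros sb2 Hsb2.
  split; [now apply restrict|split; [|split; [|split]]].
  + intros s [Is _]; destruct (e_arc s Is) as (de & H1 & H2 & H3).
    exists de; auto.
  + apply restrict; now apply (smarandache_eg_spherical openI e_sph e_unit e_arc darboux).
  + intros s Js; pose proof Js as [Is Hg].
    pose proof (smarandache_eg_derive darboux s Is) as He2.
    pose proof (smarandache_eg_arclength_derive sb2 s (Hsb2 s Js)) as Hd.
    pose proof (smarandache_eg_speed_neq0 e_unit e_arc s Is Hg) as H0.
    pose proof (darboux_tangent_unit e_arc darboux s Is) as Ht.
    eexists; split; [exact He2|split].
    * now apply fst_dvscal_unit_neq0.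
    (* The two cases are the two signs that the real part of [1 - gam] can take: [sb2] runs along
       increasing [s] or against it. *)
    * destruct (dnorm_dvscal_unit _ _ Ht H0) as [E|E]; rewrite E.
      -- left; exact Hd.
      -- right; now rewrite opp_opp.
  + intros s Js; pose proof Js as [Is Hg].
    exists (t s); split; [apply (darboux s Is)|].
    pose proof (smarandache_eg_speed_neq0 e_unit e_arc s Is Hg) as H0.
    eexists _, _; split; [exact (smarandache_eg_derive darboux s Is)|].
    split; [exact (smarandache_eg_arclength_derive sb2 s (Hsb2 s Js))|].
    split; [exact H0|now rewrite dvscal_dinv_l].
- intros s [Is _] th; unfold dual_offset_angle, e2.
  rewrite (ddot_smarandache_eg_l e_sph darboux s Is).
  pose proof PI_RGT_0 as HPI.
  split.
  + intros [Hth E]; now apply dual_ext_cos_eq_pi4.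
  + intros ->; split; [simpl; lra|].
    symmetry; apply dual_ext_cos_eq_pi4; [simpl; lra|reflexivity].
Qed.
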